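(* Let $L,L'\in\mathbb{R}_{\ge0}$, $m\in\mathbb{N}$, and suppose that a causal differentiator $\mathcal{D}$ of order $m$ is deterministically optimal over $\mathcal{F}_L^m$. Then a) $\mathcal{D}$ is exact from the beginning over $\mathcal{F}_L^m$; b) $\mathcal{D}$ is robust almost from the beginning over $\mathcal{F}_L^m$; c) $\mathcal{D}$ can be deterministically optimal over $\mathcal{F}_{L'}^m$ only if $L'=L$.
   Context: For $m\in\mathbb{N}_0$ and $L,N\ge 0$: $\mathcal{F}^m$ is the set of functions $f:\mathbb{R}_{\ge 0}\to\mathbb{R}$ that are $m$ times continuously differentiable with $f^{(m)}$ Lipschitz continuous; $\mathcal{F}_L^m=\{f\in\mathcal{F}^m: |f^{(m+1)}(t)|\le L\text{ a.e. on }\mathbb{R}_{\ge0}\}$; $\mathcal{E}_N=\{\eta:\mathbb{R}_{\ge0}\to\mathbb{R}: |\eta(t)|\le N\text{ for all }t\ge0\}$; $\mathcal{F}_L^m+\mathcal{E}_N=\{f+\eta: f\in\mathcal{F}_L^m,\eta\in\mathcal{E}_N\}$; and $\mathcal{U}=\bigcup_{m\in\mathbb{N}_0,\,L,N\ge0}(\mathcal{F}_L^m+\mathcal{E}_N)$. A differentiator of order $m$ is an operator $\mathcal{D}:\mathcal{U}\to(\mathbb{R}_{\ge0}\to\mathbb{R}^m)$, with components $\mathcal{D}_1,\dots,\mathcal{D}_m$. It is causal if for all $t\ge0$, $[\mathcal{D}u_1](t)=[\mathcal{D}u_2](t)$ whenever $u_1=u_2$ on $[0,t]$. Worst-case error over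 $\mathcal{S}\subseteq\mathcal{F}^m$: $M_{N,i}^{\mathcal{S}}(t)=\sup_{f\in\mathcal{S},\,\eta\in\mathcal{E}_N}\ \sup_{\tau\ge t}|f^{(i)}(\tau)-[\mathcal{D}_i(f+\eta)](\tau)|\in[0,\infty]$. $\mathcal{D}$ is exact from the beginning over $\mathcal{F}_L^m$ if $M_{0,i}^{\mathcal{F}_L^m}(t)=0$ for all $t>0$ and $i=1,\dots,m$. For $T>0$, $\mathcal{G}^m_{L,N}(T)=\{g\in\mathcal{F}_L^m:|g(t)|\le N\text{ for all }t\in[0,T]\}$ and $\bar g^{m,L}_{N,k}(T)=\sup\{g^{(k)}(T):g\in\mathcal{G}^m_{L,N}(T)\}$. A causal differentiator $\mathcal{D}$ of order $m$ is deterministically optimal over $\mathcal{F}_L^m$ if $M_{N,k}^{\mathcal{F}_{\ell}^m}(t)\le\bar g_{N,k}^{m,L+\ell}(t)$ for all $t>0$, $\ell\in[0,L]$, $N\ge0$ and $k\in\{1,\dots,m\}$. Robustness: for $\mathcal{S}\subseteq\mathcal{U}$ and $\epsilon>0$ let $Q^{\mathcal{S}}_{\epsilon,i}(t)=\sup_{u_1\in\mathcal{S},\,\eta\in\mathcal{E}_\epsilon}\ \sup_{\tau\ge t}|[\mathcal{D}_iu_1](\tau)-[\mathcal{D}_i(u_1+\eta)](\tau)|$ and $Q^{\mathcal{S}}_i(t)=\lim_{\epsilon\to0^+}Q^{\mathcal{S}}_{\epsilon,i}(t)$. $\mathcal{D}$ is robust almost from the beginning over $\mathcal{S}$ if $Q_i^{\mathcal{S}}(t)=0$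 for all $t>0$ and $i=1,\dots,m$. *)

(* Defs.v *)
(* Functions on R_{>= 0} (signals, and outputs of operators) are encoded as
   total functions on R of which only the restriction to [0, +oo[ is relevant:
   no definition below looks at values at negative arguments, and for causal
   operators the output at t >= 0 does not depend on them either. *)
From mathcomp Require Import all_boot all_order all_algebra.
From mathcomp Require Import all_classical all_reals all_analysis.
Set Implicit Arguments.
Unset Strict Implicit.
Unset Printing Implicit Defensive.
Import Order.TTheory GRing.Theory Num.Theory.
Import numFieldNormedType.Exports.
Local Open Scope classical_set_scope.
Local Open Scope ring_scope.

Section Signals.
Variable R : realType.
Implicit Types (f g u eta : R -> R) (t L N : R) (m k : nat).

Definition halfline : set R := [set t | 0 <= t].

(* Derivative within [0, +oo[: the usual one for t > 0, right-sided at 0. *)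
Definition diff_quotient f t (s : R) : R := (f s - f t) / (s - t).

Definition hderivable f t : Prop :=
  cvg (diff_quotient f t s @[s --> within halfline t^']).

Definition hderive f t : R :=
  lim (diff_quotient f t s @[s --> within halfline t^']).

Definition hderiven k f : R -> R := iter k hderive f.

Definition smooth_class m : set (R -> R) := [set f |
  [/\ forall k, (k < m)%N -> forall t, 0 <= t -> hderivable (hderiven k f) t,
      {within halfline, continuous (hderiven m f)}
    & [lipschitz hderiven m f x | x in halfline]]].

(* The bound on f^(m+1) includes its existence almost everywhere, since
   [hderive] is total. *)
Definition smooth_class_bound m L : set (R -> R) := [set f |
  smooth_class m f /\
  {ae (@lebesgue_measure R), forall t, 0 <= t ->
     hderivable (hderiven m f) t /\ `|hderiven m.+1 f t| <= L}].

Definition noise N : set (R -> R) :=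
  [set eta | forall t, 0 <= t -> `|eta t| <= N].

Definition measurements : set (R -> R) := [set u |
  exists m L N, [/\ 0 <= L, 0 <= N &
    exists f eta, [/\ smooth_class_bound m L f, noise N eta & u = f \+ eta]]].

End Signals.

Section Differentiators.
Variables (R : realType) (m : nat).

(* Operators are total; the values outside [measurements R] are irrelevant. *)
Definition differentiator := (R -> R) -> R -> 'rV[R]_m.

Variable D : differentiator.
Implicit Types (S : set (R -> R)) (L N t eps : R) (i : 'I_m).

(* The component i : 'I_m, counted from 0, estimates the derivative of order
   i.+1. *)
Definition component i (u : R -> R) (t : R) : R := D u t ord0 i.

Definition causal : Prop :=
  forall u1 u2, measurements u1 -> measurements u2 ->
  forall t, 0 <= t -> (forall s, 0 <= s <= t -> u1 s = u2 s) ->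
  D u1 t = D u2 t.

(* For empty S, the supremum below is -oo instead of 0. *)
Definition worst_case_error S N i t : \bar R :=
  ereal_sup [set e | exists f eta, [/\ S f, noise N eta &
    e = ereal_sup [set `|hderiven i.+1 f tau - component i (f \+ eta) tau|%:E
                  | tau in [set tau | t <= tau]]]].

Definition exact_from_beginning L : Prop :=
  forall t i, 0 < t ->
  worst_case_error (smooth_class_bound m L) 0 i t = 0%E.

Definition bounded_class L N (T : R) : set (R -> R) := [set g |
  smooth_class_bound m L g /\ forall t, 0 <= t <= T -> `|g t| <= N].

Definition gbar L N (k : nat) (T : R) : \bar R :=
  ereal_sup [set (hderiven k g T)%:E | g in bounded_class L N T].

Definition deterministically_optimal L : Prop :=
  forall t l N i, 0 < t -> 0 <= l <= L -> 0 <= N ->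
  (worst_case_error (smooth_class_bound m l) N i t
     <= gbar (L + l) N i.+1 t)%E.

Definition robustness_error S eps i t : \bar R :=
  ereal_sup [set e | exists u eta, [/\ S u, noise eps eta &
    e = ereal_sup [set `|component i u tau - component i (u \+ eta) tau|%:E
                  | tau in [set tau | t <= tau]]]].

Definition robustness_limit S i t : \bar R :=
  lim (robustness_error S eps i t @[eps --> 0^'+]).

Lemma robustness_limit_exists S i t :
  cvg (robustness_error S eps i t @[eps --> 0^'+]).
Proof.
apply: nondecreasing_at_right_is_cvge; near=> e => x y _ _ xy.
apply: ereal_sup_le => _ [u [eta [Su eta_x ->]]]; exists u, eta; split => //.
by move=> s s0; exact: le_trans (eta_x s s0) xy.
Unshelve. all: by end_near. Qed.

Definition robust_almost_from_beginning S : Prop :=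
  forall t i, 0 < t -> robustness_limit S i t = 0%E.

End Differentiators.

(* Main.v *)
(* Optimality compares the error at a noise level N with
   gbar_N = sup g^(k)(t) over g bounded by N on [0, t] with |g^(m+1)| <= 2L, and
   by a Landau-Kolmogorov type estimate gbar_N tends to 0 with N, which gives
   exactness (N = 0) and robustness (N -> 0). For uniqueness of L, let L < L'.
   Exactness over the class of level L' and causality force the error over
   polynomials of degree at most m (level 0) to be at least gbar^{L'}_N, while
   optimality at level L bounds it by gbar^L_N. But gbar is concave and
   unbounded in its level, hence strictly increasing. *)
Require Import Defs.
From mathcomp Require Import all_boot all_order all_algebra.
From mathcomp Require Import ring lra.
From mathcomp Require Import all_classical all_reals all_analysis.
Import Order.TTheory GRing.Theory Num.Theory.
Import numFieldNormedType.Exports.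
Local Open Scope classical_set_scope.
Local Open Scope ring_scope.

(** * Growth bounds from derivative bounds almost everywhere *)

(** Continuous induction: the Lipschitz condition puts the supremum of the points where [h x <= h a]
    into that set, and the local condition then leads past it, so that [b] is reached. *)
Lemma right_nonincreasing_le (R : realType) (h : R -> R) (a b K : R) :
  a <= b -> 0 <= K ->
  (forall x y, a <= x <= y -> y <= b -> `|h y - h x| <= K * (y - x)) ->
  (forall x, a <= x < b -> exists2 d, 0 < d &
     forall y, x <= y <= x + d -> y <= b -> h y <= h x) ->
  h b <= h a.
Proof.
move=> ab K0 hK hd.
pose S : set R := [set x | a <= x <= b /\ h x <= h a].
have Sa : S a by split => //; rewrite lexx ab.
have Sub : has_sup S by split; [exists a | exists b => x [/andP[]]].
have ac : a <= sup S by apply: ub_le_sup => //; case: Sub.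
have cb : sup S <= b by apply: ge_sup; [exists a | move=> x [/andP[]]].
have hc : h (sup S) <= h a.
  apply/ler_addgt0Pr => e e0.
  have K1 : 0 < K + 1 by lra.
  have e1 : 0 < e / (K + 1) by rewrite divr_gt0.
  have [x Sx xc] := sup_adherent e1 Sub.
  have xs : x <= sup S by apply: ub_le_sup => //; case: Sub.
  case: Sx => /andP[ax xb] hx.
  have := hK x (sup S) _ cb; rewrite ax xs => /(_ isT).
  rewrite ler_norml => /andP[_ hh].
  have : K * (sup S - x) <= e.
    apply: (@le_trans _ _ ((K + 1) * (e / (K + 1)))); last first.
      by rewrite mulrC divfK// gt_eqF.
    by apply: ler_pM => //; lra.
  lra.
move: cb; rewrite le_eqVlt => /orP[/eqP <- //|cb].
have [|d d0 hcd] := hd (sup S); first by rewrite ac cb.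
have [cd|cd] := leP (sup S + d) b.
  have : S (sup S + d).
    split; first by rewrite cd andbT; lra.
    by apply: le_trans hc; apply: hcd => //; lra.
  by move/(ub_le_sup (proj2 Sub)); lra.
by apply: le_trans hc; apply: hcd => //; lra.
Qed.

(* If [N] is covered by an open set [U] of measure at most [e], the function
   [f x - (L + e) x - K mu(U `&` ]a, x])] is right-nonincreasing everywhere: on
   [N] because its last term decreases with slope [K], off [N] because of the
   derivative bound. *)
Lemma ae_growth_bound (R : realType) (f : R -> R) (a b K L : R) (N : set R) :
  a <= b -> 0 <= K -> 0 <= L -> (@lebesgue_measure R).-negligible N ->
  (forall x y, a <= x <= y -> y <= b -> `|f y - f x| <= K * (y - x)) ->
  (forall x, a <= x < b -> ~ N x -> forall e, 0 < e -> exists2 d, 0 < d &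
     forall y, x <= y <= x + d -> f y - f x <= (L + e) * (y - x)) ->
  f b - f a <= L * (b - a).
Proof.
move=> ab K0 L0 [A [mA A0 NA]] fK fN.
pose mu : {measure set (measurableTypeR R) -> \bar R} := @lebesgue_measure R.
apply/ler_addgt0Pr => e0 e00.
(* The final error is [e * (b - a)], from the slope [L + e], plus [K * e], from the measure of the
   cover; together they stay below [e0]. *)
pose e := e0 / (b - a + K + 1).
have bK : 0 < b - a + K + 1 by lra.
have e_gt0 : 0 < e by rewrite divr_gt0.
have ee : (b - a + K + 1) * e = e0 by rewrite /e mulrC divfK// gt_eqF.
have [|U [oU AU UA]] := lebesgue_regularity_outer mA _ e_gt0.
  by rewrite [X in (X < _)%E]A0 ltry.
have muS X Y : measurable X -> measurable Y -> X `<=` Y -> (mu X <= mu Y)%E.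
  by move=> mX mY XY; apply: le_measure => //; exact/mem_set.
have mU : measurable U by exact: measurable_realfun.open_measurable.
have muU : (mu U < e%:E)%E.
  have -> : U = A `|` (U `\` A) by rewrite setDUK.
  rewrite measureU//; last 2 first.
    exact: measurableD.
    by rewrite setDIK.
  by rewrite [X in (X + _)%E]A0 add0e.
(* To the right of [a], [G] is nondecreasing and 1-Lipschitz, and it has slope 1 on intervals inside
   [U]; its total increase is at most [e]. *)
pose G x := fine (mu (U `&` `]a, x]%classic)).
have mUI x y : measurable (U `&` `]x, y]%classic) by exact: measurableI.
have Ufin x y : mu (U `&` `]x, y]%classic) \is a fin_num.
  rewrite ge0_fin_numE//; apply: le_lt_trans (ltry e).
  apply: le_trans (ltW muU); exact: (muS _ U (mUI x y) mU).
have Gadd x y : a <= x <= y -> G y - G x = fine (mu (U `&` `]x, y]%classic)).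
  move=> /andP[ax xy]; rewrite /G.
  have -> : U `&` `]a, y] = (U `&` `]a, x]) `|` (U `&` `]x, y]).
    rewrite -setIUr; congr (_ `&` _); apply/seteqP; split => z /=; rewrite !in_itv/=.
      by move=> /andP[az zy]; case: (leP z x) => zx; [left|right]; apply/andP.
    by case=> /andP[? ?]; apply/andP; split; lra.
  rewrite measureU; [|exact: mUI|exact: mUI|]; last first.
    apply/seteqP; split => z //= [[_ +] [_ +]]; rewrite !in_itv/=; lra.
  rewrite fineD; [by rewrite addrC addKr|exact: Ufin|exact: Ufin].
have mule x y : x <= y -> mu `]x, y]%classic = (y - x)%:E.
  move=> xy; have := lebesgue_measure_itv (`]x, y] : interval R).
  rewrite /= lte_fin => ->; case: ltP => // yx.
  by congr (_%:E); lra.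
have G0 x y : a <= x <= y -> 0 <= G y - G x.
  by move=> axy; rewrite Gadd//; exact: fine_ge0.
have G1 x y : a <= x <= y -> G y - G x <= y - x.
  move=> axy; rewrite Gadd// -lee_fin fineK// -mule; last by case/andP: axy.
  by exact: (muS _ _ (mUI x y) (measurable_itv _)).
have GU x y : a <= x <= y -> `]x, y] `<=` U -> G y - G x = y - x.
  by move=> axy xyU; rewrite Gadd// setIidr// mule//; case/andP: axy.
have Gab : G b - G a <= e.
  rewrite Gadd; last by rewrite lexx.
  rewrite -lee_fin fineK//; apply: le_trans (ltW muU).
  by exact: (muS _ U (mUI a b) mU).
have hba : f b - (L + e) * b - K * G b <= f a - (L + e) * a - K * G a.
  apply: (@right_nonincreasing_le R (fun x => f x - (L + e) * x - K * G x) a b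
    (K + (L + e) + K)) => //; first lra.
  - move=> x y axy yb /=.
    have := fK _ _ axy yb; have := G0 _ _ axy; have := G1 _ _ axy.
    case/andP: axy => ax xy; rewrite !ler_norml => g1 g0 /andP[f1 f2].
    have : 0 <= (L + e) * (y - x) by rewrite mulr_ge0//; lra.
    have : K * (G y - G x) <= K * (y - x) by rewrite ler_wpM2l.
    have : 0 <= K * (G y - G x) by rewrite mulr_ge0.
    move=> h1 h2 h3; apply/andP; split; lra.
  - move=> x /andP[ax xb].
    have [Nx|Nx] := pselect (N x).
      have := oU; rewrite openE => /(_ x (AU _ (NA _ Nx))).
      rewrite /interior => /nbhs_ballP[d /= d0 dU].
      exists (d / 2); first by lra.
      move=> y /andP[xy yd] yb.
      have axy : a <= x <= y by rewrite ax.
      have := fK _ _ axy yb; rewrite ler_norml => /andP[_ fxy].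
      have gxy : G y - G x = y - x.
        apply: GU => // z /=; rewrite in_itv/= => /andP[xz zy]; apply: dU.
        by rewrite /ball/= ltr_norml; lra.
      have : 0 <= (L + e) * (y - x) by rewrite mulr_ge0//; lra.
      have : K * (G y - G x) = K * (y - x) by rewrite gxy.
      lra.
    have [|d d0 fd] := fN x _ Nx e e_gt0; first by rewrite ax xb.
    exists d => // y xyd yb; have := fd y xyd.
    case/andP: xyd => xy yd.
    have axy : a <= x <= y by rewrite ax.
    have : 0 <= K * (G y - G x) by rewrite mulr_ge0// G0.
    lra.
have : K * (G b - G a) <= K * e by rewrite ler_wpM2l.
lra.
Qed.

(** * Small functions with Lipschitz top derivative have small derivatives *)

Lemma is_derive_MVT (R : realType) (f df : R -> R) (a b : R) : a <= b ->
  (forall x, a <= x <= b -> is_derive x 1 f (df x)) ->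
  exists2 c, a <= c <= b & f b - f a = df c * (b - a).
Proof.
move=> ab fd.
have [||c] := @MVT_segment R f df a b ab.
- move=> x; rewrite in_itv/= => /andP[ax xb]; apply: fd; lra.
- apply: derivable_within_continuous => x; rewrite in_itv/= => xab.
  by have [] := fd _ xab.
by rewrite in_itv/=; exists c.
Qed.

(** The derivatives are two-sided even at [a] and [b], so a signal on the half-line yields a tower
    only away from 0. *)
Definition derivative_tower {R : realType} (n : nat) (F : nat -> R -> R)
    (a b : R) : Prop :=
  forall k, (k < n)%N -> forall x, a <= x <= b ->
  is_derive x 1 (F k) (F k.+1 x).

Lemma derivative_towerS (R : realType) n (F : nat -> R -> R) (a b c d : R) :
  a <= c -> d <= b -> derivative_tower n.+1 F a b -> derivative_tower n F c d.
Proof. by move=> ac db Fab k kn x xcd; apply: Fab; [exact: ltnW|lra]. Qed.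

(** The induction hypothesis gives one point in each outer third of the interval where the
    derivative of order [n] is small. They are at least [w / 3] apart, so the mean value theorem
    yields a point between them, with constant [2 * C / (w / 3)]. The constant does not depend on
    [a], which allows the interval to slide. *)
Lemma small_derivative_point (R : realType) (n : nat) (w : R) : 0 < w ->
  exists2 C, 0 <= C & forall (F : nat -> R -> R) (a eps : R),
    derivative_tower n F a (a + w) ->
    (forall x, a <= x <= a + w -> `|F 0%N x| <= eps) ->
    exists2 xi, a <= xi <= a + w & `|F n xi| <= C * eps.
Proof.
elim: n w => [|n IHn] w w0.
  exists 1 => // F a eps _ Feps; exists a; first by rewrite lexx; lra.
  by rewrite mul1r Feps// lexx; lra.
have w30 : 0 < w / 3 by lra.
have [C C0 HC] := IHn _ w30.
have Cw0 : 0 <= 2 * C / (w / 3) by apply: divr_ge0; lra.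
exists (2 * C / (w / 3)) => // F a eps FD Feps.
have [||x1 x1a Fx1] := HC F a eps.
- by apply: derivative_towerS FD; lra.
- by move=> x xa; apply: Feps; lra.
have [||x2 x2a Fx2] := HC F (a + w - w / 3) eps.
- by apply: derivative_towerS FD; lra.
- by move=> x xa; apply: Feps; lra.
have [||xi xi12 Exi] := @is_derive_MVT R (F n) (F n.+1) x1 x2.
- lra.
- by move=> x x12; apply: FD => //; lra.
exists xi; first lra.
have x12 : w / 3 <= x2 - x1 by lra.
rewrite mulrAC ler_pdivlMr//.
apply: (@le_trans _ _ (`|F n.+1 xi| * (x2 - x1))); first exact: ler_wpM2l.
have x120 : 0 <= x2 - x1 by lra.
rewrite -[X in _ * X]ger0_norm// -normrM -Exi.
apply: le_trans (ler_normB _ _) _; lra.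
Qed.

(* A weak form of the Landau-Kolmogorov inequality. By induction on [n]: the
   highest derivative is small at some point of every short subinterval, hence
   everywhere by the Lipschitz condition, which makes the previous derivative
   Lipschitz with a small constant. *)
Lemma small_derivatives (R : realType) (n : nat) (a b K delta : R) :
  a < b -> 0 <= K -> 0 < delta ->
  exists2 eps, 0 < eps & forall F : nat -> R -> R,
    derivative_tower n F a b ->
    (forall x y, a <= x <= b -> a <= y <= b ->
       `|F n y - F n x| <= K * `|y - x|) ->
    (forall x, a <= x <= b -> `|F 0%N x| <= eps) ->
    forall k, (k <= n)%N -> forall x, a <= x <= b -> `|F k x| <= delta.
Proof.
move=> ab; elim: n K delta => [|n IHn] K delta K0 delta0.
  exists delta => // F _ _ F0 k; rewrite leqn0 => /eqP -> x; exact: F0.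
(* Across a window of this length the top derivative varies by at most [delta / 2]. *)
pose w := Num.min (b - a) (delta / 2 / (K + 1)).
have K1 : 0 < K + 1 by lra.
have w0 : 0 < w by rewrite lt_min !divr_gt0// andbT; lra.
have wab : w <= b - a by rewrite ge_min lexx.
have wK : K * w <= delta / 2.
  have : w <= delta / 2 / (K + 1) by rewrite ge_min lexx orbT.
  by rewrite ler_pdivlMr//; lra.
have [C C0 HC] := small_derivative_point R n.+1 w w0.
(* Once the top derivative is bounded by [delta], the same number serves as Lipschitz constant one
   order below. *)
have [eps2 eps20 Heps2] := IHn delta delta (ltW delta0) delta0.
have C1 : 0 < C + 1 by lra.
pose eps := Num.min eps2 (delta / 2 / (C + 1)).
have eps0 : 0 < eps by rewrite lt_min eps20/= !divr_gt0.
have epsC : C * eps <= delta / 2.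
  have : eps <= delta / 2 / (C + 1) by rewrite ge_min lexx orbT.
  by rewrite ler_pdivlMr//; lra.
exists eps => // F FD FK F0.
have Fn x : a <= x <= b -> `|F n.+1 x| <= delta.
  move=> xab.
  (* The window starts at [x], or is pushed left to end at [b]. *)
  pose c := Num.min x (b - w).
  have cx : c <= x by rewrite ge_min lexx.
  have cb : c <= b - w by rewrite ge_min lexx orbT.
  have ac : a <= c by rewrite le_min; apply/andP; split; lra.
  have xc : x <= c + w.
    by rewrite /c minEle; case: ifP => _; lra.
  have [||xi xic Fxi] := HC F c eps.
  - by move=> k kn y ycw; apply: FD => //; lra.
  - by move=> y ycw; apply: F0; lra.
  have FKx : `|F n.+1 x - F n.+1 xi| <= K * `|x - xi| by apply: FK => //; lra.
  have := ler_normD (F n.+1 x - F n.+1 xi) (F n.+1 xi); rewrite subrK => Fx.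
  have : K * `|x - xi| <= K * w.
    by apply: ler_wpM2l => //; rewrite ler_norml; lra.
  lra.
move=> k; rewrite leq_eqVlt => /orP[/eqP -> //|]; rewrite ltnS.
apply: Heps2.
- by move=> j jn; apply: FD; exact: ltnW.
- have Fle x y : a <= x <= b -> a <= y <= b -> x <= y ->
      `|F n y - F n x| <= delta * `|y - x|.
    move=> xab yab xy.
    have [|c cxy ->] := @is_derive_MVT R (F n) (F n.+1) x y xy.
      by move=> z zxy; apply: FD => //; lra.
    by rewrite normrM; apply: ler_wpM2r => //; apply: Fn; lra.
  move=> x y xab yab; have [xy|/ltW yx] := leP x y; first exact: Fle.
  by rewrite distrC (distrC y); exact: Fle.
- by move=> x xab; apply: (le_trans (F0 _ xab)); rewrite ge_min lexx.
Qed.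

(** * Derivatives on the half-line *)

Definition is_hderive {R : realType} (f : R -> R) (t l : R) : Prop :=
  diff_quotient f t s @[s --> within (@halfline R) t^'] --> l.

(** Without division the first-order expansion also covers [s = t]. The two-sided derivative gets
    the same form below, and the two then differ only in the condition [0 <= s]. *)
Lemma is_hderiveP (R : realType) (f : R -> R) (t l : R) :
  is_hderive f t l <->
  forall e, 0 < e -> exists2 d, 0 < d & forall s, 0 <= s -> `|s - t| < d ->
    `|f s - f t - l * (s - t)| <= e * `|s - t|.
Proof.
have E s : s != t ->
    f s - f t - l * (s - t) = (diff_quotient f t s - l) * (s - t).
  by move=> st; rewrite mulrBl /diff_quotient divfK// subr_eq0.
split.
- move=> /cvgrPdist_le H e e0.
  have /nbhs_ballP[d /= d0 dH] := H e e0.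
  exists d => // s s0 sd; have [->|st] := eqVneq s t.
    by rewrite !subrr mulr0 subr0 normr0 mulr0.
  rewrite E// normrM ler_wpM2r// distrC; apply: dH => //.
  by rewrite /ball/= distrC.
- move=> H; apply/cvgrPdist_le => e e0.
  have [d d0 dH] := H e e0.
  apply/nbhs_ballP; exists d => //= s; rewrite /ball/= distrC => sd st s0.
  have := dH s s0 sd; rewrite E// normrM distrC ler_pM2r//.
  by rewrite normr_gt0 subr_eq0.
Qed.

Lemma is_deriveP (R : realType) (f : R -> R) (t l : R) :
  is_derive t 1 f l <->
  forall e, 0 < e -> exists2 d, 0 < d & forall s, `|s - t| < d ->
    `|f s - f t - l * (s - t)| <= e * `|s - t|.
Proof.
have E s : s != t ->
    f s - f t - l * (s - t) = ((s - t)^-1 * (f s - f t) - l) * (s - t).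
  by move=> st; rewrite mulrBl mulrAC mulVf ?mul1r// subr_eq0.
have S : (fun h : R => h^-1 *: ((f \o shift t) (h *: (1 : R)) - f t)) =
    (fun h => h^-1 * (f (h + t) - f t)).
  by apply/funext => h; rewrite /= [h *: 1]mulr1.
split.
- case=> fd fl.
  have : h^-1 *: ((f \o shift t) (h *: (1 : R)) - f t) @[h --> 0^'] --> l.
    by rewrite -fl; exact: fd.
  rewrite S => /cvgrPdist_le H e e0.
  have /nbhs_ballP[d /= d0 dH] := H e e0.
  exists d => // s sd; have [->|st] := eqVneq s t.
    by rewrite !subrr mulr0 subr0 normr0 mulr0.
  rewrite E// normrM ler_wpM2r// distrC.
  have := dH (s - t); rewrite subrK; apply; last by rewrite subr_eq0.
  by rewrite /ball/= sub0r normrN.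
- move=> H.
  have C : h^-1 *: ((f \o shift t) (h *: (1 : R)) - f t) @[h --> 0^'] --> l.
    rewrite S; apply/cvgrPdist_le => e e0; have [d d0 dH] := H e e0.
    apply/nbhs_ballP; exists d => //= h; rewrite /ball/= sub0r normrN => hd h0.
    have ht : h + t - t = h by rewrite addrK.
    have := dH (h + t); rewrite E; last by rewrite -subr_eq0 ht.
    by rewrite !ht normrM => /(_ hd); rewrite distrC ler_pM2r ?normr_gt0.
  by split; [exact: cvgP C|exact: cvg_lim C].
Qed.

Lemma is_derive_is_hderive (R : realType) (f : R -> R) (t l : R) :
  is_derive t 1 f l -> is_hderive f t l.
Proof.
move=> /is_deriveP H; apply/is_hderiveP => e e0.
by have [d d0 dH] := H e e0; exists d => // s _; exact: dH.
Qed.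

Lemma is_hderive_is_derive (R : realType) (f : R -> R) (t l : R) :
  0 < t -> is_hderive f t l -> is_derive t 1 f l.
Proof.
move=> t0 /is_hderiveP H; apply/is_deriveP => e e0.
have [d d0 dH] := H e e0; exists (Num.min d t); first by rewrite lt_min d0.
move=> s; rewrite lt_min => /andP[sd st]; apply: dH => //.
by move: st; rewrite ltr_norml => /andP[? ?]; lra.
Qed.

Lemma within_halfline_proper (R : realType) (t : R) : 0 <= t ->
  ProperFilter (within (@halfline R) t^').
Proof.
move=> t0; apply: Build_ProperFilter_ex => P /nbhs_ballP[d /= d0 dH].
exists (t + d / 2); apply: dH.
- by rewrite /ball/= ltr_norml; lra.
- by rewrite gt_eqF//; lra.
- by rewrite /halfline/=; lra.
Qed.

Lemma is_hderiveE (R : realType) (f : R -> R) (t l : R) : 0 <= t ->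
  is_hderive f t l -> hderivable f t /\ hderive f t = l.
Proof.
move=> t0 H; split; first exact: cvgP H.
have PF := within_halfline_proper _ _ t0.
exact: cvg_lim H.
Qed.

Lemma hderivableP (R : realType) (f : R -> R) (t : R) :
  hderivable f t -> is_hderive f t (hderive f t).
Proof. by []. Qed.

Lemma eq_is_hderive (R : realType) (f g : R -> R) (t l : R) : 0 <= t ->
  (forall s, 0 <= s -> f s = g s) -> is_hderive f t l -> is_hderive g t l.
Proof.
move=> t0 fg /is_hderiveP H; apply/is_hderiveP => e /H[d d0 dH].
by exists d => // s s0; rewrite -!fg//; exact: dH.
Qed.

Lemma is_hderive_lincomb (R : realType) (f g : R -> R) (a b t l l' : R) :
  is_hderive f t l -> is_hderive g t l' ->
  is_hderive (fun s => a * f s + b * g s) t (a * l + b * l').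
Proof.
move=> fl gl; rewrite /is_hderive.
rewrite (_ : diff_quotient _ t =
  (fun s => a * diff_quotient f t s + b * diff_quotient g t s)); last first.
  by apply/funext => s; rewrite /diff_quotient; ring.
by apply: cvgD; apply: cvgM => //; exact: cvg_cst.
Qed.

(* The tower [F] represents the successive derivatives of [F 0]; it need only
   agree with [hderiven] on the half-line, outside of which the latter takes
   junk values. *)
Lemma hderiven_tower (R : realType) (m : nat) (F : nat -> R -> R) :
  (forall k, (k < m)%N -> forall t, 0 <= t -> is_hderive (F k) t (F k.+1 t)) ->
  forall k, (k <= m)%N -> forall t, 0 <= t -> hderiven k (F 0%N) t = F k t.
Proof.
move=> FD; elim=> [|k IHk] km t t0 //=.
apply: (proj2 (is_hderiveE _ _ _ _ t0 _)).
apply: eq_is_hderive (FD _ km _ t0) => // s s0.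
by rewrite IHk// ltnW.
Qed.

(** * Membership in the smoothness classes *)

Lemma ae_lebesgue_filter (R : realType) :
  Filter (almost_everywhere (@lebesgue_measure R)).
Proof. exact: ae_filter_ringOfSetsType. Qed.

Lemma smooth_class_bound_tower (R : realType) (m : nat) (L K : R)
    (F : nat -> R -> R) :
  (forall k, (k < m)%N -> forall t, 0 <= t -> is_hderive (F k) t (F k.+1 t)) ->
  (forall x y, 0 <= x -> 0 <= y -> `|F m y - F m x| <= K * `|y - x|) ->
  {ae (@lebesgue_measure R), forall t, 0 <= t ->
     exists2 l, is_hderive (F m) t l & `|l| <= L} ->
  smooth_class_bound m L (F 0%N).
Proof.
move=> FD FK Fae.
have FE := hderiven_tower _ _ _ FD.
split; last first.
  have PF := ae_lebesgue_filter R.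
  apply: filterS Fae => t /[swap] t0 /(_ t0)[l Fl lL].
  have /is_hderiveE[//|Hd /= ->] : is_hderive (hderiven m (F 0%N)) t l.
    by apply: eq_is_hderive Fl => // s s0; rewrite FE.
  by [].
split.
- move=> k km t t0.
  have /is_hderiveE[//|//] : is_hderive (hderiven k (F 0%N)) t (F k.+1 t).
  apply: eq_is_hderive (FD _ km _ t0) => // s s0; rewrite FE//.
  exact: ltnW.
- apply/subspace_continuousP => x x0.
  apply/cvgrPdist_le => e e0.
  (* [K] may have any sign or vanish; [|K| + 1] is a positive Lipschitz constant in every case. *)
  have K1 : 0 < `|K| + 1 by rewrite ltr_wpDl.
  apply/nbhs_ballP; exists (e / (`|K| + 1)) => /=; first by rewrite divr_gt0.
  move=> y; rewrite /ball/= => xy y0.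
  rewrite /from_subspace !FE//; apply: le_trans (FK _ _ y0 x0) _.
  apply: (@le_trans _ _ ((`|K| + 1) * `|x - y|)).
    by apply: ler_wpM2r => //; have := ler_norm K; lra.
  by rewrite mulrC -ler_pdivlMr// ltW.
- rewrite /lipschitz_on; near=> M => -[x y] [/= x0 y0]; rewrite /self_sub/= !FE//.
  rewrite distrC (distrC x); apply: le_trans (FK _ _ x0 y0) _.
  apply: ler_wpM2r => //; near: M; exact: nbhs_pinfty_ge.
Unshelve. all: by end_near. Qed.

Lemma smooth_class_is_hderive (R : realType) (m k : nat) (f : R -> R) (t : R) :
  smooth_class m f -> (k < m)%N -> 0 <= t ->
  is_hderive (hderiven k f) t (hderiven k.+1 f t).
Proof. by move=> [fd _ _] km t0; apply: hderivableP; exact: fd. Qed.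

Lemma smooth_class_lipschitz (R : realType) (m : nat) (f : R -> R) :
  smooth_class m f -> exists2 K, 0 <= K &
    forall x y, 0 <= x -> 0 <= y ->
      `|hderiven m f y - hderiven m f x| <= K * `|y - x|.
Proof.
move=> [_ _ fl]; near (pinfty_nbhs R) => K; exists K => // x y x0 y0.
have : (K.-lipschitz_(@halfline R) (hderiven m f)) by near: K.
by move=> /(_ (y, x)); apply.
Unshelve. all: by end_near. Qed.

(** The class supplies only some Lipschitz constant [K]. The almost everywhere bound improves it to
    [L] through [ae_growth_bound], where [K] controls the exceptional null set; the factors 1 and -1
    give the two signs. *)
Lemma smooth_class_bound_lipschitz (R : realType) (m : nat) (L : R)
    (f : R -> R) : 0 <= L -> smooth_class_bound m L f ->
  forall x y, 0 <= x -> 0 <= y ->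
    `|hderiven m f y - hderiven m f x| <= L * `|y - x|.
Proof.
move=> L0 [fm fae].
have [K K0 fK] := smooth_class_lipschitz _ _ _ fm.
have fd t : ~ (~` [set t | 0 <= t ->
      hderivable (hderiven m f) t /\ `|hderiven m.+1 f t| <= L]) t ->
    0 <= t -> exists2 l, is_hderive (hderiven m f) t l & `|l| <= L.
  move=> /contrapT /[apply] -[/hderivableP fl lL].
  by exists (hderiven m.+1 f t).
have growth (c : R) x y : `|c| <= 1 -> 0 <= x -> x <= y ->
    c * hderiven m f y - c * hderiven m f x <= L * (y - x).
  move=> c1 x0 xy.
  apply: (@ae_growth_bound R (fun s => c * hderiven m f s) x y K L _ xy K0 L0
    fae) => [s t /andP[xs st] ty|s /andP[xs sy] Ns e e0].
    rewrite -mulrBr normrM -[leRHS]mul1r ler_pM//.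
    by rewrite -(@ger0_norm _ (t - s)) ?subr_ge0//; apply: fK; lra.
  have s0 : 0 <= s by lra.
  have [l /is_hderiveP/(_ e e0)[d d0 fsd] lL] := fd s Ns s0.
  exists (d / 2); first lra.
  move=> t /andP[st td]; have ts : 0 <= t - s by lra.
  have := fsd t; rewrite (ger0_norm ts) => /(_ _ _)/wrap[||H]; [lra|lra|].
  have : `|c * (hderiven m f t - hderiven m f s)| <= (L + e) * (t - s).
    rewrite normrM -[leRHS]mul1r ler_pM//.
    rewrite -(subrK (l * (t - s)) (_ - _)).
    apply: le_trans (ler_normD _ _) _.
    rewrite mulrDl addrC lerD// normrM (ger0_norm ts).
    exact: ler_wpM2r.
  by apply: le_trans; rewrite -mulrBr ler_norm.
have bound x y : 0 <= x -> x <= y ->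
    `|hderiven m f y - hderiven m f x| <= L * `|y - x|.
  move=> x0 xy; rewrite (@ger0_norm _ (y - x)) ?subr_ge0// ler_norml.
  have := growth 1 x y _ x0 xy; rewrite normr1 lexx => /(_ isT).
  have := growth (-1) x y _ x0 xy; rewrite normrN normr1 lexx => /(_ isT).
  by move=> h1 h2; apply/andP; split; lra.
move=> x y x0 y0; have [xy|/ltW yx] := leP x y; first exact: bound.
by rewrite distrC (distrC y); exact: bound.
Qed.

Lemma smooth_class_bound_lincomb (R : realType) (m : nat) (L1 L2 a b : R)
    (f g : R -> R) : 0 <= L1 -> 0 <= L2 ->
  smooth_class_bound m L1 f -> smooth_class_bound m L2 g ->
  smooth_class_bound m (`|a| * L1 + `|b| * L2) (fun s => a * f s + b * g s) /\
  forall k, (k <= m)%N -> forall t, 0 <= t ->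
    hderiven k (fun s => a * f s + b * g s) t
    = a * hderiven k f t + b * hderiven k g t.
Proof.
move=> L10 L20 fm gm.
pose F k s := a * hderiven k f s + b * hderiven k g s.
have FD k : (k < m)%N -> forall t, 0 <= t -> is_hderive (F k) t (F k.+1 t).
  move=> km t t0; apply: is_hderive_lincomb.
    by apply: smooth_class_is_hderive km t0; case: fm.
  by apply: smooth_class_is_hderive km t0; case: gm.
split; last exact: (hderiven_tower _ _ F FD).
apply: (smooth_class_bound_tower _ _ _ (`|a| * L1 + `|b| * L2) F FD).
- move=> x y x0 y0; rewrite /F.
  have -> : a * hderiven m f y + b * hderiven m g y -
      (a * hderiven m f x + b * hderiven m g x) =
      a * (hderiven m f y - hderiven m f x) +
      b * (hderiven m g y - hderiven m g x) by ring.
  apply: le_trans (ler_normD _ _) _; rewrite !normrM mulrDl -!mulrA.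
  by apply: lerD; apply: ler_wpM2l => //; exact: smooth_class_bound_lipschitz.
- have PF := ae_lebesgue_filter R.
  case: fm gm => [_ fae] [_ gae].
  apply: filterS2 fae gae => t fl gl t0.
  have [/hderivableP fd fL] := fl t0; have [/hderivableP gd gL] := gl t0.
  exists (F m.+1 t); first exact: is_hderive_lincomb.
  apply: le_trans (ler_normD _ _) _; rewrite !normrM.
  by apply: lerD; exact: ler_wpM2l.
Qed.

Lemma smooth_class_bound_derive (R : realType) (m : nat) (L : R)
    (F : nat -> R -> R) :
  (forall (k : nat) (t : R), is_derive t 1 (F k) (F k.+1 t)) ->
  (forall t, `|F m.+1 t| <= L) ->
  smooth_class_bound m L (F 0%N).
Proof.
move=> FD FL; apply: (smooth_class_bound_tower _ _ _ L F).
- by move=> k _ t _; exact: is_derive_is_hderive.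
- have bound x y : x <= y -> `|F m y - F m x| <= L * `|y - x|.
    move=> xy.
    have [c cxy ->] :=
      @is_derive_MVT R (F m) (F m.+1) x y xy (fun z _ => FD m z).
    by rewrite normrM; exact: ler_wpM2r.
  move=> x y _ _; have [xy|/ltW yx] := leP x y; first exact: bound.
  by rewrite distrC (distrC y); exact: bound.
- apply: aeW => t t0; exists (F m.+1 t); last exact: FL.
  exact: is_derive_is_hderive.
Qed.

Definition sinusoid {R : realType} (a w p x : R) : R := a * sin (w * x + p).

(** Each differentiation multiplies the amplitude by [w] and advances the phase by [pi / 2], so all
    derivatives remain sinusoids. *)
Lemma smooth_class_bound_sinusoid (R : realType) (m : nat) (a w p : R) :
  smooth_class_bound m (`|a * w ^+ m.+1|) (sinusoid a w p) /\
  forall k t, 0 <= t -> hderiven k (sinusoid a w p) t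
    = sinusoid (a * w ^+ k) w (p + k%:R * (pi / 2)) t.
Proof.
pose F k := sinusoid (a * w ^+ k) w (p + k%:R * (pi / 2)).
have F0 : sinusoid a w p = F 0%N by rewrite /F expr0 mulr1 mul0r addr0.
have FD k (t : R) : is_derive t 1 (F k) (F k.+1 t).
  rewrite /F /sinusoid.
  apply: is_derive_eq.
  have -> : p + k.+1%:R * (pi / 2) = p + k%:R * (pi / 2) + pi / 2.
    by rewrite -natr1; ring.
  by rewrite !addrA sinDpihalf exprSr /GRing.scale/=; ring.
rewrite F0; split.
  apply: smooth_class_bound_derive => // t.
  rewrite /F /sinusoid normrM -[leRHS]mulr1.
  by apply: ler_wpM2l => //; rewrite ler_norml sin_geN1 sin_le1.
move=> k t t0; apply: (hderiven_tower _ k F) => // j _ s _.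
exact: is_derive_is_hderive.
Qed.

Lemma smooth_class_bound0 (R : realType) (m : nat) (L : R) : 0 <= L ->
  smooth_class_bound m L (fun=> 0) /\
  forall k t, 0 <= t -> hderiven k (fun=> 0 : R) t = 0.
Proof.
move=> L0; have D0 (t : R) : is_derive t 1 (fun=> 0 : R) (0 : R).
  exact: is_derive_cst.
split.
  apply: (@smooth_class_bound_derive R m L (fun _ _ => 0)) => // t.
  by rewrite normr0.
move=> k t t0; apply: (hderiven_tower _ k (fun _ _ => 0)) => // j _ s _.
exact: is_derive_is_hderive.
Qed.

(** * Vanishing of [gbar] with the noise level *)

Lemma bounded_class_small_derivatives (R : realType) (m : nat) (L T delta : R) :
  0 <= L -> 0 < T -> 0 < delta -> exists2 eps, 0 < eps &
    forall g, bounded_class m L eps T g ->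
    forall k, (k <= m)%N -> `|hderiven k g T| <= delta.
Proof.
move=> L0 T0 delta0.
(* On [[T / 2, T]] the half-line derivatives are two-sided. *)
have TT : T / 2 < T by lra.
have [eps eps0 H] := @small_derivatives R m (T / 2) T L delta TT L0 delta0.
exists eps => // g [gm geps] k km.
apply: (H (fun k => hderiven k g)) => //.
- move=> j jm x xT; apply: is_hderive_is_derive; first lra.
  by apply: smooth_class_is_hderive jm _; [case: gm|lra].
- by move=> x y xT yT; apply: smooth_class_bound_lipschitz gm _ _ _ _ => //; lra.
- by move=> x xT; apply: geps; lra.
- by lra.
Qed.

Lemma smooth_class_boundS (R : realType) (m : nat) (L L' : R) : L <= L' ->
  smooth_class_bound m L `<=` smooth_class_bound m L'.
Proof.
move=> LL' f [fm fae]; split => //.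
have PF := ae_lebesgue_filter R.
by apply: filterS fae => t ft /ft[fd fL]; split => //; exact: le_trans LL'.
Qed.

Lemma gbar_small (R : realType) (m : nat) (L T delta : R) :
  0 <= L -> 0 < T -> 0 < delta -> exists2 eps, 0 < eps &
    forall N, N <= eps -> forall k, (k <= m)%N ->
      (gbar m L N k T <= delta%:E)%E.
Proof.
move=> L0 T0 delta0.
have [eps eps0 H] := bounded_class_small_derivatives R m L T delta L0 T0 delta0.
exists eps => // N Neps k km; apply: ge_ereal_sup => _ [g [gm gN] <-].
rewrite lee_fin; apply: le_trans (ler_norm _) _; apply: H => //; split => //.
by move=> t tT; exact: le_trans (gN _ tT) Neps.
Qed.

(** * Exactness and robustness *)

Lemma worst_case_error_ub (R : realType) (m : nat) (D : differentiator R m)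
    (S : set (R -> R)) (N t tau : R) (i : 'I_m) (f eta : R -> R) :
  S f -> noise N eta -> t <= tau ->
  (`|hderiven i.+1 f tau - component D i (f \+ eta) tau|%:E
    <= worst_case_error D S N i t)%E.
Proof.
move=> Sf Neta ttau; apply: (@le_trans _ _ (ereal_sup
  [set `|hderiven i.+1 f tau - component D i (f \+ eta) tau|%:E
  | tau in [set tau | t <= tau]])); apply: ereal_sup_ubound; first by exists tau.
by exists f, eta.
Qed.

Lemma noise0 (R : realType) (N : R) : 0 <= N -> noise N (fun=> 0 : R).
Proof. by move=> N0 t _; rewrite normr0. Qed.

Lemma addf0 (R : realType) (f : R -> R) : f \+ (fun=> 0) = f.
Proof. by apply/funext => x /=; rewrite addr0. Qed.

Lemma deterministically_optimal_exact (R : realType) (m : nat)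
    (D : differentiator R m) (L : R) :
  0 <= L -> deterministically_optimal D L -> exact_from_beginning D L.
Proof.
move=> L0 Dopt t i t0; apply/eqP; rewrite eq_le; apply/andP; split.
  apply/lee_addgt0Pr => e e0; rewrite add0e.
  have LL0 : 0 <= L + L by lra.
  have [eps eps0 H] := gbar_small R m (L + L) t e LL0 t0 e0.
  apply: le_trans (H 0 (ltW eps0) i.+1 (ltn_ord i)).
  by apply: Dopt; rewrite ?L0 ?lexx.
(* The zero signal belongs to the class, so the supremum is at least 0 rather than -oo. *)
apply: (@le_trans _ _ `|hderiven i.+1 (fun=> 0) t
    - component D i ((fun=> 0) \+ (fun=> 0)) t|%:E); first by rewrite lee_fin.
apply: worst_case_error_ub => //; last exact: noise0.
by case: (smooth_class_bound0 R m L L0).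
Qed.

Lemma exact_from_beginningP (R : realType) (m : nat) (D : differentiator R m)
    (L t : R) (i : 'I_m) (f : R -> R) :
  exact_from_beginning D L -> 0 < t -> smooth_class_bound m L f ->
  component D i f t = hderiven i.+1 f t.
Proof.
move=> Dex t0 fL.
have := worst_case_error_ub R m D _ 0 t t i _ _ fL
  (noise0 R 0 (lexx 0)) (lexx t).
rewrite addf0 Dex// lee_fin normr_le0 subr_eq0 => /eqP ->//.
Qed.

(** By exactness the output on an unperturbed signal is its true derivative, so the robustness error
    is bounded by the worst-case error, and hence by [gbar] at level [L + L]. *)
Lemma deterministically_optimal_robust (R : realType) (m : nat)
    (D : differentiator R m) (L : R) :
  0 <= L -> deterministically_optimal D L ->
  robust_almost_from_beginning D (smooth_class_bound m L).
Proof.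
move=> L0 Dopt t i t0.
have Dex := deterministically_optimal_exact R m D L L0 Dopt.
apply/eqP; rewrite eq_le; apply/andP; split.
- apply/lee_addgt0Pr => e e0; rewrite add0e.
  have LL0 : 0 <= L + L by lra.
  have [eps eps0 H] := gbar_small R m (L + L) t e LL0 t0 e0.
  apply: lime_le; first exact: robustness_limit_exists.
  near=> N.
  have N0 : 0 <= N by [].
  have Neps : N <= eps by near: N; exact: nbhs_right_le.
  apply: ge_ereal_sup => _ [u [eta [uL etaN ->]]].
  apply: ge_ereal_sup => _ [tau /= ttau <-].
  rewrite (exact_from_beginningP _ _ _ _ _ _ _ Dex _ uL); last lra.
  apply: le_trans (H N Neps i.+1 (ltn_ord i)).
  apply: le_trans (Dopt t L N i t0 _ N0); last by rewrite L0 lexx.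
  exact: worst_case_error_ub.
- apply: lime_ge; first exact: robustness_limit_exists.
  near=> N.
  have N0 : 0 <= N by [].
  apply: (@le_trans _ _ `|component D i (fun=> 0) t
    - component D i ((fun=> 0) \+ (fun=> 0)) t|%:E); first by rewrite lee_fin.
  apply: (@le_trans _ _ (ereal_sup
    [set `|component D i (fun=> 0) tau
      - component D i ((fun=> 0) \+ (fun=> 0)) tau|%:E
    | tau in [set tau | t <= tau]])); apply: ereal_sup_ubound.
    by exists t => //=.
  exists (fun=> 0), (fun=> 0); split => //; last exact: noise0.
  by case: (smooth_class_bound0 R m L L0).
Unshelve. all: by end_near. Qed.

(** * Uniqueness of the level *)

(* The truncation of [g] is a noise that makes the zero signal
   indistinguishable from [g] on [0, T]. *)
Lemma causal_exact_derivative_le (R : realType) (m : nat)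
    (D : differentiator R m) (L' N T : R) (i : 'I_m) (g : R -> R) :
  0 <= L' -> 0 <= N -> 0 < T -> causal D -> exact_from_beginning D L' ->
  bounded_class m L' N T g ->
  ((hderiven i.+1 g T)%:E
    <= worst_case_error D (smooth_class_bound m 0) N i T)%E.
Proof.
move=> L'0 N0 T0 Dc Dex [gL gN].
have [Z0 Zd] := smooth_class_bound0 R m 0 (lexx 0).
pose eta s := if s <= T then g s else 0.
have etaN : noise N eta.
  move=> s s0; rewrite /eta; case: ifP => sT; last by rewrite normr0.
  by apply: gN; rewrite s0.
(* By causality the output at [T] is the one for [g], where exactness at level [L'] applies. *)
have Dg : component D i ((fun=> 0) \+ eta) T = hderiven i.+1 g T.
  rewrite -(exact_from_beginningP _ _ _ _ _ _ _ Dex T0 gL) /component.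
  rewrite (Dc _ g _ _ T (ltW T0))//.
  - by exists m, 0, N; split => //; exists (fun=> 0), eta.
  - exists m, L', 0; split => //; exists g, (fun=> 0).
    by rewrite addf0; split => //; exact: noise0.
  - by move=> s /andP[s0 sT] /=; rewrite add0r /eta sT.
apply: le_trans (worst_case_error_ub R m D _ N T T i _ _ Z0 etaN (lexx T)).
by rewrite Dg Zd ?(ltW T0)// sub0r normrN lee_fin ler_norm.
Qed.

(* Mixing a function of level [L] with a little of a steep sinusoid of amplitude
   [N] stays within level [L'] and raises the derivative at 1. *)
Lemma deterministically_optimal_nlt (R : realType) (m : nat)
    (D : differentiator R m) (L L' : R) : (0 < m)%N -> 0 <= L -> L < L' ->
  causal D -> deterministically_optimal D L ->
  deterministically_optimal D L' -> False.
Proof.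
move=> m0 L0 LL' Dc DL DL'.
have L'0 : 0 <= L' by lra.
have Dex := deterministically_optimal_exact R m D L' L'0 DL'.
(* [N] is chosen so that [gbar] at level [L] is at most 1, below the slope 2 of the sinusoid
   introduced later. *)
have [N N0 HN] := gbar_small R m L 1 1 L0 ltr01 ltr01.
pose i := Ordinal m0.
(* The error over level 0 lies above the derivative of [g] at 1, by exactness at level [L'], and
   below [gbar] at level [L + 0], by optimality. *)
have key g : bounded_class m L' N 1 g ->
    ((hderiven 1 g 1)%:E <= gbar m L N 1 1)%E.
  move=> gL'; have := DL 1 0 N i ltr01; rewrite lexx L0 ltW// addr0.
  move=> /(_ isT isT); apply: le_trans.
  exact: (@causal_exact_derivative_le R m D L' N 1 i g L'0 (ltW N0) ltr01).
have [Z0 Zd] := smooth_class_bound0 R m L L0.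
have G1 : (gbar m L N 1 1 <= 1%:E)%E by exact: HN.
have G0 : (0%:E <= gbar m L N 1 1)%E.
  apply: ereal_sup_ubound; exists (fun=> 0); last by rewrite Zd.
  by split => // t _; rewrite normr0 ltW.
have [G EG] : exists G : R, gbar m L N 1 1 = G%:E.
  by move: G0 G1; case: gbar => // G _ _; exists G.
rewrite EG lee_fin in G1.
(* With phase [- w] the derivative at 1 is maximal and equals [N * w = 2]. *)
pose w := 2 / N.
have [sL sd] := smooth_class_bound_sinusoid R m N w (- w).
set s := sinusoid N w (- w) in sL sd.
have s1 : hderiven 1 s 1 = 2.
  rewrite sd// /sinusoid mul1r mulr1 addrA subrr add0r sin_pihalf mulr1 expr1.
  by rewrite /w mulrC divfK// gt_eqF.
set L2 := `|N * w ^+ m.+1| in sL.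
have L20 : 0 <= L2 by exact: normr_ge0.
have L21 : 0 < L2 + 1 by lra.
(* The first bound keeps the weight [1 - th] positive; the second keeps the mixed level
   [(1 - th) * L + th * L2] below [L']. *)
pose th := Num.min 2^-1 ((L' - L) / (L2 + 1)).
have th0 : 0 < th by rewrite lt_min invr_gt0 ltr0n/= divr_gt0// subr_gt0.
have th1 : th <= 2^-1 by rewrite ge_min lexx.
have thL : th * L2 <= L' - L.
  have : th <= (L' - L) / (L2 + 1) by rewrite ge_min lexx orbT.
  by rewrite ler_pdivlMr//; lra.
have mix g : bounded_class m L N 1 g ->
    (1 - th) * hderiven 1 g 1 + th * 2 <= G.
  move=> [gL gN].
  have [hL hd] := smooth_class_bound_lincomb
    R m L L2 (1 - th) th g s L0 L20 gL sL.
  rewrite -s1 -hd// -lee_fin -EG; apply: key; split.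
    apply: smooth_class_boundS hL; rewrite !ger0_norm; [|lra|lra].
    have : 0 <= th * L by rewrite mulr_ge0// ltW.
    lra.
  move=> t t01; apply: le_trans (ler_normD _ _) _.
  rewrite (normrM (1 - th)) (normrM th) (ger0_norm (ltW th0)).
  rewrite (@ger0_norm _ (1 - th)); last lra.
  have -> : N = (1 - th) * N + th * N by ring.
  apply: lerD; apply: ler_wpM2l; [lra|exact: gN|lra|].
  rewrite /s /sinusoid normrM -[leRHS]mulr1 (ger0_norm (ltW N0)).
  by apply: ler_wpM2l; [exact: ltW|rewrite ler_norml sin_geN1 sin_le1].
have th10 : 0 < 1 - th by lra.
(* Passing to the supremum over [g] turns [mix] into [(1 - th) * G + th * 2 <= G], that is [2 <= G],
   against [G <= 1]. *)
have : (gbar m L N 1 1 <= ((G - th * 2) / (1 - th))%:E)%E.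
  apply: ge_ereal_sup => _ [g gL <-]; rewrite lee_fin ler_pdivlMr//.
  by have := mix g gL; lra.
rewrite EG lee_fin ler_pdivlMr// => HG.
have : th * 2 <= th * G by lra.
by rewrite ler_pM2l//; lra.
Qed.

Theorem proposition5p10 (R : realType) (L L' : R) (m : nat)
  (D : differentiator R m) :
  0 <= L -> 0 <= L' -> (0 < m)%N ->
  causal D -> deterministically_optimal D L ->
  [/\ exact_from_beginning D L,
      robust_almost_from_beginning D (@smooth_class_bound R m L)
    & deterministically_optimal D L' -> L' = L].
Proof.
move=> L0 L'0 m0 Dc Dopt; split.
- exact: deterministically_optimal_exact.
- exact: deterministically_optimal_robust.
- move=> Dopt'; case: (ltgtP L' L) => // LL'.
  (* Optimality holds at both levels, so either strict order is excluded by exchanging their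
     roles. *)
  + by case: (@deterministically_optimal_nlt R m D L' L).
  + by case: (@deterministically_optimal_nlt R m D L L').
Qed.
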